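(* For every cubic polynomial $p\in\mathbb{C}[Z]$ there exist starting points $\underline z\in\mathbb{C}^3$ such that the iterates $W_p^{\circ n}(\underline z)$ are defined for all $n\ge0$ and each of the three coordinates of $W_p^{\circ n}(\underline z)$ tends to $\infty$ in absolute value as $n\to\infty$. The set of such escaping points contains a holomorphic curve.
   Context: For a monic polynomial $p\in\mathbb{C}[Z]$ of degree $d$, the Weierstrass map $W_p$ is the partially defined map $\mathbb{C}^d\setminus\Delta\to\mathbb{C}^d$, $\underline z\mapsto \underline z'$ with $z'_k=z_k-\dfrac{p(z_k)}{\prod_{j\ne k}(z_k-z_j)}$, where $\Delta=\{\underline z\in\mathbb{C}^d: z_j=z_k\text{ for some }j<k\}$. For non-monic $p$ with leading coefficient $c$, $W_p:=W_{p/c}$. *)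

(* Defs.v *)
From mathcomp Require Import all_boot all_order all_algebra.
From mathcomp Require Import complex.
From mathcomp Require Import all_classical all_reals all_analysis.
Import numFieldNormedType.Exports.
Import GRing.Theory Num.Theory.

Set Implicit Arguments.
Unset Strict Implicit.
Unset Printing Implicit Defensive.

Local Open Scope ring_scope.
Local Open Scope complex_scope.

(* The Weierstrass map W_p for p of degree d (leading coefficient c),
   as a total function on 'I_d -> F.  On the complement of the big
   diagonal (i.e. for injective z) it coincides with the partially
   defined map of the paper: W_p := W_{p/c},
   z'_k = z_k - (p/c)(z_k) / prod_{j<>k} (z_k - z_j). *)
Definition weierstrass (F : fieldType) (d : nat) (p : {poly F})
    (z : 'I_d -> F) : 'I_d -> F :=
  fun k => z k - p.[z k] / lead_coef p / \prod_(j < d | j != k) (z k - z j).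

Definition off_diagonal (F : fieldType) (d : nat) (z : 'I_d -> F) : Prop :=
  injective z.

Definition orbit_defined (F : fieldType) (d : nat) (p : {poly F})
    (z : 'I_d -> F) : Prop :=
  forall n : nat, off_diagonal (iter n (weierstrass p) z).

Definition escaping (R : realType) (d : nat) (p : {poly R[i]})
    (z : 'I_d -> R[i]) : Prop :=
  orbit_defined p z /\
  forall (k : 'I_d) (M : R),
    \forall n \near (eventually : set_system nat),
      M%:C < `| iter n (weierstrass p) z k |.

Definition holomorphic_on_disk (R : realType) (c : R[i]) (r : R)
    (f : R[i] -> R[i]) : Prop :=
  forall t : R[i], `| t - c | < r%:C ->
    @derivable R[i] (R[i])^o (R[i])^o (f : (R[i])^o -> (R[i])^o) t 1.

(* Main.v *)
(* On the plane of triples with centroid [a] (the centroid of the roots), write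
   z = (a + m + d, a + m - d, a - 2 m) and use r = m / d and t = 1 / d; infinity
   is t = 0.  Up to exchanging the first two coordinates, W_p becomes
     r' = mean_ratio r t / gap_ratio r t,   t' = t / gap_ratio r t,
   which has a saddle at t = 0, r^2 = (11 - 4 sqrt 7) / 3: the derivative of r' in
   r is - (6 + sqrt 7), and t is multiplied by - 3 / (1 + sqrt 7), so orbits
   that stay near this point escape.  Such an orbit is the fixed point of a
   contraction on the pairs of bounded sequences (r_n, t_n), in which the
   expanding equation is solved backwards.

   For the curve, W_p maps C^3 into a plane, so its fibres are curves; the fibre
   over the image w of an escaping point consists of escaping points.  In the
   coordinates t = z_3, S = z_1 + z_2, D = z_1 - z_2 (relative to [a]) one fibre
   equation is linear in S and D and the other is quadratic, so S and D are given
   by a branch of a square root as holomorphic functions of t. *)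
Require Import Defs.
From mathcomp Require Import all_boot all_order all_algebra.
From mathcomp Require Import complex.
From mathcomp Require Import all_classical all_reals all_analysis.
From mathcomp Require Import ring lra.
Import numFieldNormedType.Exports.
Import Order.TTheory GRing.Theory Num.Theory.
Import ComplexField.Normc.
Local Open Scope ring_scope.
Local Open Scope complex_scope.
Local Open Scope classical_set_scope.

Set Implicit Arguments.
Unset Strict Implicit.
Unset Printing Implicit Defensive.

(** * Norms and contractions *)

Lemma normr_normc (R : rcfType) (x : R[i]) : `|x| = (normc x)%:C.
Proof. by []. Qed.

Lemma normc_ge0 (R : rcfType) (x : R[i]) : 0 <= normc x.
Proof. by rewrite -lecR -normr_normc normr_ge0. Qed.

Lemma normc_gt0 (R : rcfType) (x : R[i]) : (0 < normc x) = (x != 0).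
Proof. by rewrite -ltcR -normr_normc normr_gt0. Qed.

Lemma ler_normcD (R : rcfType) (x y : R[i]) : normc (x + y) <= normc x + normc y.
Proof. exact: le_normcD. Qed.

Lemma normc_distC (R : rcfType) (x y : R[i]) : normc (x - y) = normc (y - x).
Proof. by rewrite -normcN opprB. Qed.

Lemma normc_ler_add (R : rcfType) (x y z : R[i]) :
  normc (x - z) <= normc (x - y) + normc (y - z).
Proof. by have := ler_normcD (x - y) (y - z); rewrite addrA subrK. Qed.

Lemma ler_Re_normc (R : rcfType) (x : R[i]) : `|complex.Re x| <= normc x.
Proof. by rewrite -lecR -normr_normc normc_ge_Re. Qed.

Lemma ler_Im_normc (R : rcfType) (x : R[i]) : `|complex.Im x| <= normc x.
Proof.
have := ler_Re_normc (x * 'i%C); rewrite ReiNIm normrN normcM.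
by rewrite [normc 'i%C]/= expr0n expr1n add0r sqrtr1 mulr1.
Qed.

Lemma normc_le_ReIm (R : rcfType) (x : R[i]) : normc x <= `|complex.Re x| + `|complex.Im x|.
Proof.
rewrite {1}[x]complexE (le_trans (ler_normcD _ _))// normcM.
have nR (u : R) : normc u%:C = `|u| by rewrite /= expr0n addr0 sqrtr_sqr.
by rewrite !nR [normc 'i%C]/= expr0n expr1n add0r sqrtr1 mul1r.
Qed.

Lemma normc_real (R : rcfType) (x : R) : normc x%:C = `|x|.
Proof. by rewrite /= expr0n addr0 sqrtr_sqr. Qed.

(** Nested intervals: with [e n] the tail of the geometric series from index [n] on, [u n - e n]
    increases and [u n + e n] decreases, and the supremum of the lower ends lies in every
    interval. *)
Lemma geometric_limit_real (R : realType) (u : nat -> R) (D k : R) :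
  0 <= k < 1 -> (forall n, `|u n.+1 - u n| <= D * k ^+ n) ->
  exists x, forall n, `|x - u n| <= D * k ^+ n / (1 - k).
Proof.
move=> /andP[k0 k1] uD; have k1' : 0 < 1 - k by rewrite subr_gt0.
pose e n := D * k ^+ n / (1 - k).
have eS n : e n - e n.+1 = D * k ^+ n.
  by rewrite /e exprS; field; rewrite lt0r_neq0.
have aS n : u n - e n <= u n.+1 - e n.+1.
  by have := uD n; have := eS n; rewrite ler_norml => + /andP[]; lra.
have bS n : u n.+1 + e n.+1 <= u n + e n.
  by have := uD n; have := eS n; rewrite ler_norml => + /andP[]; lra.
have D0 : 0 <= D by have := uD 0%N; rewrite expr0 mulr1; apply: le_trans.
have e0 n : 0 <= e n by rewrite /e divr_ge0 ?mulr_ge0 ?exprn_ge0 ?(ltW k1').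
have a_mono m n : (m <= n)%N -> u m - e m <= u n - e n.
  move=> /subnK <-; elim: (n - m)%N => // i ih.
  by rewrite (le_trans ih)// addSn.
have b_mono m n : (m <= n)%N -> u n + e n <= u m + e m.
  move=> /subnK <-; elim: (n - m)%N => // i ih.
  by rewrite (le_trans _ ih)// addSn.
have ab m n : u m - e m <= u n + e n.
  have [mn|/ltnW nm] := leqP m n.
    by have := a_mono _ _ mn; have := e0 n; lra.
  by have := b_mono _ _ nm; have := e0 m; lra.
pose S : set R := fun y => exists n, u n - e n = y.
have supS : has_sup S.
  split; first by exists (u 0%N - e 0%N); exists 0%N.
  by exists (u 0%N + e 0%N) => _ [n <-].
exists (sup S) => n; rewrite -/(e n) ler_norml.
have h1 : u n - e n <= sup S by apply: sup_upper_bound => //; exists n.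
have h2 : sup S <= u n + e n.
  by apply: ge_sup; [case: supS|move=> _ [m <-]].
by apply/andP; split; lra.
Qed.

(** The factor 2 comes from treating real and imaginary parts separately. *)
Lemma geometric_limit_complex (R : realType) (u : nat -> R[i]) (D k : R) :
  0 <= k < 1 -> (forall n, normc (u n.+1 - u n) <= D * k ^+ n) ->
  exists x, forall n, normc (x - u n) <= 2 * D * k ^+ n / (1 - k).
Proof.
move=> k01 uD.
have [|x Hx] := @geometric_limit_real R (fun n => complex.Re (u n)) D k k01.
  move=> n; apply: le_trans (uD n); apply: le_trans (ler_Re_normc _).
  by rewrite raddfB.
have [|y Hy] := @geometric_limit_real R (fun n => complex.Im (u n)) D k k01.
  move=> n; apply: le_trans (uD n); apply: le_trans (ler_Im_normc _).
  by rewrite raddfB.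
exists (x +i* y) => n; apply: le_trans (normc_le_ReIm _) _.
have -> : 2 * D * k ^+ n / (1 - k) = D * k ^+ n / (1 - k) + D * k ^+ n / (1 - k) by lra.
have := lerD (Hx n) (Hy n).
by case: (u n).
Qed.

(** Banach's fixed point theorem on the closed ball of radius [delta] around [x0] for the sup
    distance. Bounds uniform in the index replace a norm on families, and the limit of the iterates
    is taken index by index at a rate that does not depend on the index. *)
Lemma sup_contraction (R : realType) (I : Type) (T : (I -> R[i]) -> I -> R[i])
    (x0 : I -> R[i]) (delta k : R) :
  0 <= k < 1 -> 0 <= delta ->
  (forall x y D, (forall i, normc (x i - x0 i) <= delta) ->
     (forall i, normc (y i - x0 i) <= delta) ->
     (forall i, normc (x i - y i) <= D) ->
     forall i, normc (T x i - T y i) <= k * D) ->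
  (forall i, normc (T x0 i - x0 i) <= (1 - k) * delta) ->
  exists x, (forall i, normc (x i - x0 i) <= delta) /\ forall i, T x i = x i.
Proof.
move=> k01 d0 contr start; have /andP[k0 k1] := k01.
have k1' : 0 < 1 - k by rewrite subr_gt0.
pose B x := forall i, normc (x i - x0 i) <= delta.
have B0 : B x0 by move=> i; rewrite subrr normc0.
have BT x : B x -> B (T x).
  move=> Bx i; have := contr x x0 delta Bx B0 Bx i; have := start i.
  by have := normc_ler_add (T x i) (T x0 i) (x0 i); lra.
pose u n := iter n T x0.
have Bu n : B (u n) by elim: n => // n; apply: BT.
have uS n i : normc (u n.+1 i - u n i) <= delta * k ^+ n.
  elim: n i => [|n IH] i.
    rewrite expr0 mulr1; have := start i.
    by have : 0 <= k * delta by [exact: mulr_ge0]; rewrite /u /=; lra.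
  by rewrite exprS mulrCA; exact: (contr _ _ _ (Bu n.+1) (Bu n) IH).
have lim i : exists x, forall n, normc (x - u n i) <= 2 * delta * k ^+ n / (1 - k).
  exact: (@geometric_limit_complex _ (fun n => u n i)).
have [x Hx] := boolp.choice lim.
(* Passage to the limit, used first to keep [x] in the ball and then to show that it is fixed. *)
have small (a c : R) : 0 <= c -> (forall n, a <= c * k ^+ n) -> a <= 0.
  move=> c0 H; rewrite leNgt; apply/negP => a0.
  have : (fun n => c * k ^+ n) @ \oo --> (0 : R).
    by rewrite -[0](mulr0 c); apply: cvgMr; apply: cvg_expr; rewrite ger0_norm.
  move=> /cvgrPdist_lt/(_ _ a0) [N _ /(_ N (leqnn N))] /=.
  rewrite sub0r normrN ger0_norm ?mulr_ge0 ?exprn_ge0// => /lt_le_trans/(_ (H N)).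
  by rewrite ltxx.
have Bx : B x.
  move=> i; rewrite -subr_le0; apply: (small _ (2 * delta / (1 - k))).
    by rewrite divr_ge0 ?mulr_ge0 ?(ltW k1').
  move=> n; have := normc_ler_add (x i) (u n i) (x0 i); have := Hx i n.
  have := Bu n i.
  have -> : 2 * delta * k ^+ n / (1 - k) = 2 * delta / (1 - k) * k ^+ n by lra.
  lra.
exists x; split => // i; apply/eqP; rewrite -subr_eq0; apply/eqP/eq0_normc/eqP.
rewrite eq_le normc_ge0 andbT.
(* With [E n] the distance bound in [Hx], [T x] is within [k * E n] of [u n.+1], which is within
   [E n.+1 = k * E n] of [x]; the sum is at most [2 * E n]. *)
apply: (small _ (4 * delta / (1 - k))).
  by rewrite divr_ge0 ?mulr_ge0 ?(ltW k1').
move=> n.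
have h1 := contr x (u n) _ Bx (Bu n) (fun i => Hx i n) i.
have h2 := Hx i n.+1.
have h3 := normc_ler_add (T x i) (u n.+1 i) (x i).
rewrite (normc_distC (x i)) in h2.
rewrite [u n.+1 i]/= -/(u n) in h2 h3.
have e : 0 <= 2 * delta * k ^+ n / (1 - k).
  by rewrite divr_ge0 ?mulr_ge0 ?exprn_ge0 ?(ltW k1').
have h4 : 2 * delta * k ^+ n.+1 / (1 - k) = k * (2 * delta * k ^+ n / (1 - k)).
  by rewrite exprS; lra.
have h5 : k * (2 * delta * k ^+ n / (1 - k)) <= 2 * delta * k ^+ n / (1 - k).
  by rewrite ler_piMl// ltW.
have -> : 4 * delta / (1 - k) * k ^+ n = 2 * (2 * delta * k ^+ n / (1 - k)) by lra.
lra.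
Qed.

(** * Strict differentiability *)

Definition near_pt (R : realType) (a b : R[i]) (P : R[i] -> R[i] -> Prop) : Prop :=
  exists2 delta : R, 0 < delta & forall x y,
    normc (x - a) <= delta -> normc (y - b) <= delta -> P x y.

(** Strict differentiability at [(a, b)] with value [v] and partial derivatives [alpha], [beta].
    Both points vary near [(a, b)], so the estimate makes the remainder Lipschitz with a small
    constant, which is what a contraction argument needs. *)
Definition strict_diff (R : realType) (a b : R[i]) (f : R[i] -> R[i] -> R[i])
    (v alpha beta : R[i]) : Prop :=
  f a b = v /\ forall e : R, 0 < e -> exists2 delta : R, 0 < delta &
    forall x y x' y',
      normc (x - a) <= delta -> normc (y - b) <= delta ->
      normc (x' - a) <= delta -> normc (y' - b) <= delta ->
      normc (f x y - f x' y' - (alpha * (x - x') + beta * (y - y'))) <=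
        e * (normc (x - x') + normc (y - y')).

Lemma near_pt_and (R : realType) (a b : R[i]) (P Q : R[i] -> R[i] -> Prop) :
  near_pt a b P -> near_pt a b Q -> near_pt a b (fun x y => P x y /\ Q x y).
Proof.
move=> [d d0 dP] [d' d'0 dQ]; exists (Num.min d d'); first by rewrite lt_min d0.
by move=> x y; rewrite !le_min => /andP[? ?] /andP[? ?]; split; auto.
Qed.

Lemma normc_linear (R : realType) (al be x y : R[i]) :
  normc (al * x + be * y) <= (normc al + normc be) * (normc x + normc y).
Proof.
apply: le_trans (ler_normcD _ _) _; rewrite !normcM.
have := normc_ge0 al; have := normc_ge0 be; have := normc_ge0 x; have := normc_ge0 y.
nra.
Qed.

Section StrictDiff.
Variables (R : realType) (a b : R[i]).
Implicit Types f g : R[i] -> R[i] -> R[i].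

Lemma strict_diff_cont f v al be : strict_diff a b f v al be ->
  forall e, 0 < e -> near_pt a b (fun x y => normc (f x y - v) <= e).
Proof.
move=> [fv fd] e e0; have [d d0 H] := fd 1 ltr01.
pose M := normc al + normc be + 1.
have M0 : 0 < M by rewrite ltr_wpDl ?addr_ge0 ?normc_ge0.
exists (Num.min d (e / M / 2)); first by rewrite lt_min d0 !divr_gt0.
move=> x y; rewrite !le_min => /andP[xa xe] /andP[ya ye].
have z0 (z : R[i]) : normc (z - z) <= d by rewrite subrr normc0 ltW.
have := H x y a b xa ya (z0 _) (z0 _); rewrite fv => h1.
have h2 := normc_linear al be (x - a) (y - b).
have h3 := ler_normcD (f x y - v - (al * (x - a) + be * (y - b)))
  (al * (x - a) + be * (y - b)).
rewrite subrK in h3.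
have h4 : M * (normc (x - a) + normc (y - b)) <= M * (e / M).
  by rewrite ler_pM2l//; lra.
rewrite [X in _ <= X]mulrC divfK ?gt_eqF// in h4.
by rewrite /M in h4; lra.
Qed.

Lemma strict_diff_neq f v al be w : strict_diff a b f v al be -> v != w ->
  near_pt a b (fun x y => f x y != w).
Proof.
move=> fd vw; have e0 : 0 < normc (v - w) / 2.
  by rewrite divr_gt0// normc_gt0 subr_eq0.
have [d d0 H] := strict_diff_cont fd e0; exists d => // x y xa yb.
apply/eqP => fw; have := H x y xa yb; rewrite fw normc_distC; lra.
Qed.

Lemma strict_diff_cst v : strict_diff a b (fun _ _ => v) v 0 0.
Proof.
split=> // e e0; exists 1 => // x y x' y' _ _ _ _.
by rewrite !mul0r addr0 !subrr normc0 mulr_ge0 ?addr_ge0 ?normc_ge0 ?(ltW e0).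
Qed.

Lemma strict_diff_fst : strict_diff a b (fun x _ => x) a 1 0.
Proof.
split=> // e e0; exists 1 => // x y x' y' _ _ _ _.
by rewrite mul1r mul0r addr0 subrr normc0 mulr_ge0 ?addr_ge0 ?normc_ge0 ?(ltW e0).
Qed.

Lemma strict_diff_snd : strict_diff a b (fun _ y => y) b 0 1.
Proof.
split=> // e e0; exists 1 => // x y x' y' _ _ _ _.
by rewrite mul1r mul0r add0r subrr normc0 mulr_ge0 ?addr_ge0 ?normc_ge0 ?(ltW e0).
Qed.

Lemma strict_diffD f g v w al be ga de :
  strict_diff a b f v al be -> strict_diff a b g w ga de ->
  strict_diff a b (fun x y => f x y + g x y) (v + w) (al + ga) (be + de).
Proof.
move=> [fv fd] [gv gd]; split; first by rewrite fv gv.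
move=> e e0; have e2 : 0 < e / 2 by rewrite divr_gt0.
have [d d0 H] := fd _ e2; have [d' d'0 H'] := gd _ e2.
exists (Num.min d d'); first by rewrite lt_min d0.
move=> x y x' y'; rewrite !le_min => /andP[? ?] /andP[? ?] /andP[? ?] /andP[? ?].
have h1 : normc (f x y - f x' y' - (al * (x - x') + be * (y - y'))) <=
  e / 2 * (normc (x - x') + normc (y - y')) by exact: H.
have h2 : normc (g x y - g x' y' - (ga * (x - x') + de * (y - y'))) <=
  e / 2 * (normc (x - x') + normc (y - y')) by exact: H'.
set L := al * (x - x') + be * (y - y') in h1.
set L' := ga * (x - x') + de * (y - y') in h2.
have -> : f x y + g x y - (f x' y' + g x' y') -
    ((al + ga) * (x - x') + (be + de) * (y - y')) =
  (f x y - f x' y' - L) + (g x y - g x' y' - L') by rewrite /L /L'; ring.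
have := ler_normcD (f x y - f x' y' - L) (g x y - g x' y' - L'); lra.
Qed.

Lemma strict_diffM f g v w al be ga de :
  strict_diff a b f v al be -> strict_diff a b g w ga de ->
  strict_diff a b (fun x y => f x y * g x y) (v * w)
    (al * w + v * ga) (be * w + v * de).
Proof.
move=> fd gd; have [fv fe] := fd; have [gv ge] := gd.
split; first by rewrite fv gv.
move=> e e0.
pose M := normc v + normc w + (normc al + normc be) + (normc ga + normc de) + 1.
have nv := normc_ge0 v; have nw := normc_ge0 w.
have nal := normc_ge0 al; have nbe := normc_ge0 be.
have nga := normc_ge0 ga; have nde := normc_ge0 de.
have M0 : 0 < M by rewrite /M; lra.
(* The bound 1 keeps the two factors below [M] in norm; the other bound makes each of the four error
   terms at most [e / 4 * N]. *)
have e1 : 0 < Num.min 1 (e / (M * 4)) by rewrite lt_min ltr01 divr_gt0 ?mulr_gt0.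
have [d1 d10 H1] := fe _ e1; have [d2 d20 H2] := ge _ e1.
have [d3 d30 H3] := strict_diff_cont fd e1.
have [d4 d40 H4] := strict_diff_cont gd e1.
exists (Num.min (Num.min d1 d2) (Num.min d3 d4)); first by rewrite !lt_min d10 d20 d30.
move=> x y x' y'; rewrite !le_min.
move=> /andP[/andP[? ?] /andP[? ?]] /andP[/andP[? ?] /andP[? ?]].
move=> /andP[/andP[? ?] /andP[? ?]] /andP[/andP[? ?] /andP[? ?]].
set L1 := al * (x - x') + be * (y - y').
set L2 := ga * (x - x') + de * (y - y').
set N := normc (x - x') + normc (y - y').
have N0 : 0 <= N by rewrite addr_ge0 ?normc_ge0.
set k := Num.min _ _ in e1 H1 H2 H3 H4.
have h1 : normc (f x y - f x' y' - L1) <= k * N by exact: H1.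
have h2 : normc (g x y - g x' y' - L2) <= k * N by exact: H2.
have h3 : normc (f x y - v) <= k by exact: H3.
have h4 : normc (g x' y' - w) <= k by exact: H4.
have l1 : normc L1 <= (normc al + normc be) * N by exact: normc_linear.
have l2 : normc L2 <= (normc ga + normc de) * N by exact: normc_linear.
have k1 : k <= 1 by rewrite /k ge_min lexx.
have kM : M * k <= e / 4.
  have : k <= e / (M * 4) by rewrite /k ge_min lexx orbT.
  by rewrite ler_pdivlMr ?mulr_gt0//; lra.
have f1 : normc (f x y) <= M.
  by have := ler_normcD (f x y - v) v; rewrite subrK /M; lra.
have g1 : normc (g x' y') <= M.
  by have := ler_normcD (g x' y' - w) w; rewrite subrK /M; lra.
have -> : f x y * g x y - f x' y' * g x' y' -
  ((al * w + v * ga) * (x - x') + (be * w + v * de) * (y - y')) =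
  (f x y * (g x y - g x' y' - L2) + (f x y - v) * L2) +
  (g x' y' * (f x y - f x' y' - L1) + (g x' y' - w) * L1).
  by rewrite /L1 /L2; ring.
have prod (p q : R[i]) P Q : normc p <= P -> normc q <= Q -> normc (p * q) <= P * Q.
  by move=> hp hq; rewrite normcM ler_pM ?normc_ge0.
have s1 := prod _ _ _ _ f1 h2; have s2 := prod _ _ _ _ h3 l2.
have s3 := prod _ _ _ _ g1 h1; have s4 := prod _ _ _ _ h4 l1.
apply: le_trans (ler_normcD _ _) _.
have := ler_normcD (f x y * (g x y - g x' y' - L2)) ((f x y - v) * L2).
have := ler_normcD (g x' y' * (f x y - f x' y' - L1)) ((g x' y' - w) * L1).
have kN : 0 <= k * N by rewrite mulr_ge0// ltW.
have t1 : (M * k) * N <= e / 4 * N by rewrite ler_wpM2r.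
have t2 : k * ((normc ga + normc de) * N) <= M * k * N.
  by rewrite mulrCA -mulrA ler_wpM2r// /M; lra.
have t3 : k * ((normc al + normc be) * N) <= M * k * N.
  by rewrite mulrCA -mulrA ler_wpM2r// /M; lra.
lra.
Qed.

Lemma strict_diffV f v al be : strict_diff a b f v al be -> v != 0 ->
  strict_diff a b (fun x y => (f x y)^-1) v^-1 (- al / v ^+ 2) (- be / v ^+ 2).
Proof.
move=> fd vn0; have [fv fe] := fd; split; first by rewrite fv.
move=> e e0.
pose c := normc v; have c0 : 0 < c by rewrite normc_gt0.
pose M := normc al + normc be + 1.
have M0 : 0 < M by rewrite ltr_wpDl ?addr_ge0 ?normc_ge0.
(* The bound [c / 2] keeps [f] away from 0, so that the denominator [p * q] has norm at least
   [c * c / 4]. The remaining constants make each of the two terms of the numerator at most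
   [e * c ^+ 2 / 8 * N]. *)
pose k1 := Num.min (c / 2) (e * c ^+ 3 / (M * 24)).
have k10 : 0 < k1 by rewrite lt_min !divr_gt0 ?mulr_gt0 ?exprn_gt0.
pose k2 := e * c ^+ 2 / 8.
have k20 : 0 < k2 by rewrite !divr_gt0 ?mulr_gt0 ?exprn_gt0.
have [d1 d10 H1] := fe _ k20.
have [d2 d20 H2] := strict_diff_cont fd k10.
exists (Num.min d1 d2); first by rewrite lt_min d10.
move=> x y x' y'; rewrite !le_min => /andP[? ?] /andP[? ?] /andP[? ?] /andP[? ?].
set L := al * (x - x') + be * (y - y').
set N := normc (x - x') + normc (y - y').
have N0 : 0 <= N by rewrite addr_ge0 ?normc_ge0.
have h1 : normc (f x y - f x' y' - L) <= k2 * N by exact: H1.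
have h2 : normc (f x y - v) <= k1 by exact: H2.
have h3 : normc (f x' y' - v) <= k1 by exact: H2.
have l1 : normc L <= M * N.
  apply: le_trans (normc_linear _ _ _ _) _.
  by rewrite ler_wpM2r// /M; lra.
set p := f x y in h1 h2 *; set q := f x' y' in h1 h3 *.
have k1c : k1 <= c / 2 by rewrite ge_min lexx.
have pc : c / 2 <= normc p.
  by have := ler_normcD (v - p) p; rewrite subrK normc_distC -/c; lra.
have qc : c / 2 <= normc q.
  by have := ler_normcD (v - q) q; rewrite subrK normc_distC -/c; lra.
have p2 : normc p <= 2 * c.
  by have := ler_normcD (p - v) v; rewrite subrK -/c; lra.
have pn0 : p != 0 by rewrite -normc_gt0; lra.
have qn0 : q != 0 by rewrite -normc_gt0; lra.
have -> : p^-1 - q^-1 - (- al / v ^+ 2 * (x - x') + - be / v ^+ 2 * (y - y')) =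
  (- (p - q - L) + L * (p * (q - v) + v * (p - v)) / v ^+ 2) / (p * q).
  by rewrite /L; field; rewrite pn0 qn0 vn0.
rewrite normcM normcV ler_pdivrMr ?normc_gt0 ?mulf_neq0// [normc (p * q)]normcM.
apply: le_trans (ler_normcD _ _) _; rewrite normcN !normcM normcV [normc (v ^+ 2)]normcM -/c.
have cc : 0 < c * c by rewrite mulr_gt0.
have pq : c * c / 4 <= normc p * normc q.
  have -> : c * c / 4 = (c / 2) * (c / 2) by lra.
  by rewrite ler_pM// divr_ge0 ?ltW.
have s1 : normc (p * (q - v) + v * (p - v)) <= 3 * c * k1.
  apply: le_trans (ler_normcD _ _) _; rewrite !normcM -/c.
  have : normc p * normc (q - v) <= 2 * c * k1 by rewrite ler_pM ?normc_ge0.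
  have : c * normc (p - v) <= c * k1 by rewrite ler_pM2l.
  lra.
have s2 : normc L * normc (p * (q - v) + v * (p - v)) <= M * N * (3 * c * k1).
  by rewrite ler_pM ?normc_ge0.
have s3 : M * N * (3 * c * k1) / (c * c) <= e * c ^+ 2 / 8 * N.
  rewrite ler_pdivrMr//.
  have : k1 <= e * c ^+ 3 / (M * 24) by rewrite ge_min lexx orbT.
  rewrite ler_pdivlMr ?mulr_gt0// => hk.
  have : k1 * (M * 24) * (c * N) <= e * c ^+ 3 * (c * N).
    by rewrite ler_wpM2r// mulr_ge0// ltW.
  by rewrite !exprS expr0; lra.
have s4 : normc L * normc (p * (q - v) + v * (p - v)) / (c * c) <=
    M * N * (3 * c * k1) / (c * c) by rewrite ler_pM2r// invr_gt0.
have s5 : e * N * (c * c / 4) <= e * N * (normc p * normc q).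
  by rewrite ler_wpM2l// mulr_ge0// ltW.
by rewrite /k2 !exprS expr0 in h1 s3 *; lra.
Qed.

End StrictDiff.

Lemma strict_diffX (R : realType) (a b : R[i]) (f : R[i] -> R[i] -> R[i])
    (v al be : R[i]) n :
  strict_diff a b f v al be ->
  strict_diff a b (fun x y => f x y ^+ n) (v ^+ n)
    (n%:R * v ^+ n.-1 * al) (n%:R * v ^+ n.-1 * be).
Proof.
move=> fd; elim: n => [|n IH].
  by rewrite expr0 !mul0r; apply: strict_diff_cst.
have := strict_diffM fd IH; under eq_fun do under eq_fun do rewrite -exprS.
(* The exponent [n.-1] is truncated at [n = 0], where the factor [n%:R] vanishes; hence the separate
   case. *)
rewrite -exprS; congr strict_diff; rewrite -natr1; case: n {IH} => [|n] /=.
- by rewrite expr0; ring.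
- by rewrite exprS; ring.
- by rewrite expr0; ring.
- by rewrite exprS; ring.
Qed.

Lemma strict_diffN (R : realType) (a b : R[i]) (f : R[i] -> R[i] -> R[i])
    (v al be : R[i]) :
  strict_diff a b f v al be ->
  strict_diff a b (fun x y => - f x y) (- v) (- al) (- be).
Proof.
move=> fd; have := strict_diffM (strict_diff_cst a b (-1)) fd.
under eq_fun do under eq_fun do rewrite mulN1r.
by rewrite !mul0r !add0r !mulN1r.
Qed.

Lemma strict_diffB (R : realType) (a b : R[i]) (f g : R[i] -> R[i] -> R[i])
    (v w al be ga de : R[i]) :
  strict_diff a b f v al be -> strict_diff a b g w ga de ->
  strict_diff a b (fun x y => f x y - g x y) (v - w) (al - ga) (be - de).
Proof. by move=> fd gd; apply: strict_diffD => //; apply: strict_diffN. Qed.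

Lemma strict_diff_eq (R : realType) (a b : R[i]) (f : R[i] -> R[i] -> R[i])
    (v al be v' al' be' : R[i]) :
  strict_diff a b f v al be -> v = v' -> al = al' -> be = be' ->
  strict_diff a b f v' al' be'.
Proof. by move=> ? <- <- <-. Qed.

(** * Orbits near a saddle *)

(** The [r] direction expands by [mu] and the [t] direction contracts by [nu]. An orbit that stays
    near the saddle is found as a whole, as a fixed point in the space of pairs of sequences, with
    the initial value of [t] prescribed and that of [r] left free. *)
Lemma saddle_orbit (R : realType) (r0 : R[i]) (f h : R[i] -> R[i] -> R[i])
    (mu nu al be : R[i]) (P : R[i] -> R[i] -> Prop) :
  strict_diff r0 0 f r0 mu 0 -> strict_diff r0 0 h nu al be ->
  1 < normc mu -> nu != 0 -> normc nu < 1 -> near_pt r0 0 P ->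
  exists r t : nat -> R[i], [/\ forall n, r n.+1 = f (r n) (t n),
    forall n, t n.+1 = t n * h (r n) (t n), forall n, P (r n) (t n),
    forall n, t n != 0 &
    exists2 k : R, 0 <= k < 1 & forall n, normc (t n) <= normc (t 0%N) * k ^+ n].
Proof.
move=> fd hd mu1 nu0 nu1 nP.
have mup : 0 < normc mu by exact: lt_trans mu1.
pose M := Num.max (normc mu)^-1 (normc nu).
have M1 : M < 1 by rewrite gt_max nu1 andbT invf_lt1.
have M0 : 0 <= M by rewrite le_max normc_ge0 orbT.
have muM : (normc mu)^-1 <= M by rewrite le_max lexx.
have nuM : normc nu <= M by rewrite le_max lexx orbT.
(* [M] bounds both linear rates, and a remainder with constant [e] in each of two variables adds
   [2 * e]; thus [k = (1 + M) / 2]. *)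
pose e := (1 - M) / 4; pose k := M + 2 * e.
have e0 : 0 < e by rewrite /e; lra.
have k01 : 0 <= k < 1 by apply/andP; split; rewrite /k /e; lra.
(* At [t = 0] the product [t * h r t] has derivative 0 in [r] and [nu] in [t], whatever [al] and
   [be] are. *)
have thd := strict_diffM (strict_diff_snd r0 0) hd.
have [d1 d10 H1] := fd.2 _ e0.
have [d2 d20 H2] := thd.2 _ e0.
have [d3 d30 H3] := strict_diff_cont hd e0.
have [d4 d40 H4] := strict_diff_neq hd nu0.
have [d5 d50 H5] := nP.
pose d := Num.min (Num.min d1 d2) (Num.min d3 (Num.min d4 d5)).
have d0 : 0 < d by rewrite !lt_min d10 d20 d30 d40.
(* The largest initial [t] for which the first step moves [x0] by at most [(1 - k) * d]; it is
   nonzero, so the orbit leaves the invariant line [t = 0]. *)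
pose tau : R[i] := ((1 - k) * d)%:C.
pose x0 (i : nat + nat) : R[i] := if i is inl _ then r0 else 0.
(* The left summand indexes the [r_n], the right one the [t_n]. Fixed points of the first clause
   satisfy [r n.+1 = f (r n) (t n)]; there the linear part of [f] cancels [x (inl n)], which leaves
   [mu^-1 * x (inl n.+1)] and a small remainder. *)
pose T (x : nat + nat -> R[i]) (i : nat + nat) : R[i] :=
  match i with
  | inl n => x (inl n) + mu^-1 * (x (inl n.+1) - f (x (inl n)) (x (inr n)))
  | inr 0 => tau
  | inr n.+1 => x (inr n) * h (x (inl n)) (x (inr n))
  end.
have mu0 : mu != 0 by rewrite -normc_gt0.
have /andP[k0 k1] := k01.
have [|i|x [xB xT]] := @sup_contraction R (nat + nat) T x0 d k k01 (ltW d0).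
- move=> x y D xd yd xyD.
  have D0 : 0 <= D by apply: le_trans (xyD (inl 0%N)); apply: normc_ge0.
  have dle : d <= d1 /\ d <= d2 by rewrite /d !ge_min !lexx !orbT.
  have xl n : normc (x (inl n) - r0) <= d := xd (inl n).
  have xr n : normc (x (inr n) - 0) <= d := xd (inr n).
  have yl n : normc (y (inl n) - r0) <= d := yd (inl n).
  have yr n : normc (y (inr n) - 0) <= d := yd (inr n).
  have lD n : normc (x (inl n) - y (inl n)) <= D := xyD (inl n).
  have rD n : normc (x (inr n) - y (inr n)) <= D := xyD (inr n).
  have eD : 0 <= e * D by rewrite mulr_ge0// ltW.
  have sumD n : e * (normc (x (inl n) - y (inl n)) + normc (x (inr n) - y (inr n)))
      <= 2 * (e * D).
    by rewrite mulrCA ler_pM2l//; have := lD n; have := rD n; lra.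
  case=> [n|[|n]]; rewrite /T.
  + have /= h1 := H1 _ _ _ _ (le_trans (xl n) dle.1) (le_trans (xr n) dle.1)
      (le_trans (yl n) dle.1) (le_trans (yr n) dle.1).
    set A := f _ _ in h1 *; set B := f _ _ in h1 *.
    have -> : x (inl n) + mu^-1 * (x (inl n.+1) - A) -
        (y (inl n) + mu^-1 * (y (inl n.+1) - B)) =
      mu^-1 * ((x (inl n.+1) - y (inl n.+1)) +
        - (A - B - (mu * (x (inl n) - y (inl n)) + 0 * (x (inr n) - y (inr n))))).
      by field.
    rewrite normcM normcV.
    have h2 : normc (x (inl n.+1) - y (inl n.+1) +
       - (A - B - (mu * (x (inl n) - y (inl n)) + 0 * (x (inr n) - y (inr n)))))
       <= D + 2 * (e * D).
      apply: le_trans (ler_normcD _ _) _; rewrite normcN.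
      by have := lD n.+1; have := sumD n; lra.
    have h3 := ler_pM (_ : 0 <= (normc mu)^-1) (normc_ge0 _) muM h2.
    apply: le_trans (h3 _) _; first by rewrite invr_ge0 normc_ge0.
    have : M * (e * D) <= e * D by rewrite ler_piMl// ltW.
    by rewrite /k; lra.
  + by rewrite subrr normc0 mulr_ge0.
  + have /= h1 := H2 _ _ _ _ (le_trans (xl n) dle.2) (le_trans (xr n) dle.2)
      (le_trans (yl n) dle.2) (le_trans (yr n) dle.2).
    rewrite !mul0r !mul1r !addr0 mul0r add0r in h1.
    set A := _ * h _ _ in h1 *; set B := _ * h _ _ in h1 *.
    have -> : A - B = nu * (x (inr n) - y (inr n)) +
      (A - B - nu * (x (inr n) - y (inr n))) by ring.
    apply: le_trans (ler_normcD _ _) _; rewrite normcM.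
    have h2 := ler_pM (normc_ge0 _) (normc_ge0 _) nuM (rD n).
    by have := sumD n; rewrite /k; lra.
- case: i => [n|[|n]]; rewrite /T /x0.
  + by rewrite fd.1 subrr mulr0 addr0 subrr normc0 mulr_ge0 ?subr_ge0 ?ltW.
  + by rewrite subr0 normc_real ger0_norm ?lexx ?mulr_ge0 ?subr_ge0 ?ltW.
  + by rewrite mul0r subrr normc0 mulr_ge0 ?subr_ge0 ?ltW.
have dle : [/\ d <= d3, d <= d4 & d <= d5] by rewrite /d !ge_min !lexx !orbT.
have [de3 de4 de5] := dle.
have xl n : normc (x (inl n) - r0) <= d := xB (inl n).
have xr n : normc (x (inr n) - 0) <= d := xB (inr n).
have tS n : x (inr n.+1) = x (inr n) * h (x (inl n)) (x (inr n)) by rewrite -(xT (inr n.+1)).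
have t0 : x (inr 0%N) = tau by rewrite -xT.
have tn0 n : x (inr n) != 0.
  elim: n => [|n IH].
    by rewrite t0 -normc_gt0 normc_real normr_gt0 mulf_neq0 ?gt_eqF ?subr_gt0.
  rewrite tS mulf_neq0// H4//; first exact: le_trans (xl n) _.
  exact: le_trans (xr n) _.
exists (fun n => x (inl n)), (fun n => x (inr n)); split=> //.
- move=> n; have := xT (inl n) => /= /eqP.
  rewrite -subr_eq0 [X in X - _]addrC addrK mulf_eq0 invr_eq0 (negbTE mu0) /=.
  by rewrite subr_eq0 => /eqP.
- by move=> n; apply: H5; [apply: le_trans (xl n) _|apply: le_trans (xr n) _].
- exists k => // n; elim: n => [|n IH]; first by rewrite expr0 mulr1.
  rewrite tS normcM exprSr mulrA ler_pM ?normc_ge0//.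
  have := H3 _ _ (le_trans (xl n) de3) (le_trans (xr n) de3).
  have := ler_normcD (h (x (inl n)) (x (inr n)) - nu) nu.
  by rewrite subrK /k; lra.
Qed.

(** * The saddle at infinity *)

(** This is [m' / d], where [m'] is the mean parameter of the image and [b], [c] are the
    coefficients of the depressed cubic. *)
Definition mean_ratio (F : fieldType) (b c r t : F) : F :=
  r - (8 * r ^+ 3 + 2 * b * (r * t ^+ 2) - c * t ^+ 3) * (2 * (9 * r ^+ 2 - 1))^-1.

(* The sign is opposite to that of d' / d: it includes the exchange of the first
   two coordinates. *)
Definition gap_ratio (F : fieldType) (b c r t : F) : F :=
  (3 * r ^+ 4 + 6 * r ^+ 2 - 1 + b * ((3 * r ^+ 2 - 1) * t ^+ 2)
    + 3 * c * (r * t ^+ 3)) * (2 * (9 * r ^+ 2 - 1))^-1 - 1.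


(** Serves to show that expressions in [q] with [q ^+ 2 = 7] do not vanish: the inverse is written
    down explicitly and [field] checks it modulo that relation. *)
Lemma neq0_of_mulr_eq1 (F : fieldType) (x y : F) : x * y = 1 -> x != 0.
Proof. by move=> xy; apply/eqP => x0; move/eqP: xy; rewrite x0 mul0r eq_sym oner_eq0. Qed.

Section Saddle.
Variables (R : realType) (b c r0 q : R[i]).
Hypotheses (hq : q ^+ 2 = 7) (hr : r0 ^+ 2 = (11 - 4 * q) / 3).
Let iden := (8 + 3 * q) / 8.
Let rho := (11 - 4 * q) / 3.

Lemma den_mul : 2 * (9 * r0 ^+ 2 - 1) * iden = 1.
Proof. by rewrite hr /iden; field: hq. Qed.

Lemma den_neq0 : 2 * (9 * r0 ^+ 2 - 1) != 0.
Proof. exact: neq0_of_mulr_eq1 den_mul. Qed.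

Lemma denV : (2 * (9 * r0 ^+ 2 - 1))^-1 = iden.
Proof. by apply: (mulfI den_neq0); rewrite den_mul divff// den_neq0. Qed.

Lemma iden_neq0 : iden != 0.
Proof. by rewrite -denV invr_neq0// den_neq0. Qed.

Lemma strict_diff_denV :
  strict_diff r0 0 (fun r _ => (2 * (9 * r ^+ 2 - 1))^-1)
    iden (- (36 * r0) * iden ^+ 2) 0.
Proof.
have r := strict_diff_fst r0 0; have k x := strict_diff_cst r0 0 x.
have := strict_diffV (strict_diffM (k 2) (strict_diffB (strict_diffM (k 9)
  (strict_diffX 2 r)) (k 1))) den_neq0.
rewrite -exprVn denV => H; apply: (strict_diff_eq H) => //=; ring.
Qed.

(** The value is [r0] times that of [gap_ratio], which makes [r0] a fixed point of the quotient.
    Since [t] enters only through [t ^+ 2] and [t ^+ 3], the derivative in [t] vanishes at [t = 0].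
    The derivative in [r] stays in terms of [rho] and [iden]; its reduction modulo [q ^+ 2 = 7] is
    done for the quotient. *)
Lemma strict_diff_mean_ratio :
  strict_diff r0 0 (mean_ratio b c) (- ((1 + q) / 3) * r0)
   (1 - 24 * rho * iden + 288 * rho ^+ 2 * iden ^+ 2) 0.
Proof.
have r := strict_diff_fst r0 0; have k x := strict_diff_cst r0 0 x.
have t := strict_diff_snd r0 0.
have H := strict_diffB r (strict_diffM (strict_diffB (strict_diffD
  (strict_diffM (k 8) (strict_diffX 3 r))
  (strict_diffM (k (2 * b)) (strict_diffM r (strict_diffX 2 t))))
  (strict_diffM (k c) (strict_diffX 3 t))) strict_diff_denV).
have r3 : r0 ^+ 3 = rho * r0 by rewrite exprSr hr.
apply: (strict_diff_eq H) => /=; last by ring.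
  by rewrite ?r3 /rho /iden; field: hq.
have -> : rho = r0 ^+ 2 by rewrite hr.
ring.
Qed.

Lemma strict_diff_gap_ratio :
  strict_diff r0 0 (gap_ratio b c) (- ((1 + q) / 3))
   (r0 * (12 * (rho + 1) * iden
      - 36 * (3 * rho ^+ 2 + 6 * rho - 1) * iden ^+ 2)) 0.
Proof.
have r := strict_diff_fst r0 0; have k x := strict_diff_cst r0 0 x.
have t := strict_diff_snd r0 0.
have H := strict_diffB (strict_diffM (strict_diffD (strict_diffD (strict_diffB (strict_diffD
  (strict_diffM (k 3) (strict_diffX 4 r))
  (strict_diffM (k 6) (strict_diffX 2 r))) (k 1))
  (strict_diffM (k b) (strict_diffM (strict_diffB
    (strict_diffM (k 3) (strict_diffX 2 r)) (k 1)) (strict_diffX 2 t))))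
  (strict_diffM (k (3 * c)) (strict_diffM r (strict_diffX 3 t)))) strict_diff_denV) (k 1).
have r4 : r0 ^+ 4 = rho ^+ 2 by rewrite /rho -hr; ring.
apply: (strict_diff_eq H) => /=; last by ring.
  by rewrite r4 hr /rho /iden; field: hq.
have -> : rho = r0 ^+ 2 by rewrite hr.
ring.
Qed.

Lemma gap_ratio_neq0 : - ((1 + q) / 3) != 0.
Proof. by apply: (@neq0_of_mulr_eq1 _ _ ((1 - q) / 2)); field: hq. Qed.

Lemma strict_diff_quotient :
  strict_diff r0 0 (fun r t => mean_ratio b c r t * (gap_ratio b c r t)^-1)
    r0 (- (6 + q)) 0.
Proof.
have H := strict_diffM strict_diff_mean_ratio
  (strict_diffV strict_diff_gap_ratio gap_ratio_neq0).
have q1 : 1 + q != 0.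
  by apply: (@neq0_of_mulr_eq1 _ _ ((q - 1) / 6)); field: hq.
apply: (strict_diff_eq H).
- by field.
- set B := 12 * (rho + 1) * iden - _.
  have lamV : (- ((1 + q) / 3))^-1 = (1 - q) / 2.
    by apply: (mulfI gap_ratio_neq0); rewrite divff ?gap_ratio_neq0//; field: hq.
  rewrite -exprVn lamV.
  (* The value of [mean_ratio] and the derivative of [gap_ratio] each carry one factor [r0], so only
     [r0 ^+ 2] remains and the multiplier is an expression in [q] alone. *)
  have -> : - ((1 + q) / 3) * r0 * (- (r0 * B) * ((1 - q) / 2) ^+ 2) =
    (1 + q) / 3 * r0 ^+ 2 * B * ((1 - q) / 2) ^+ 2 by ring.
  by rewrite hr /B /rho /iden; field: hq.
- by field.
Qed.
End Saddle.

(** The orbit supplied by the saddle, with the side conditions used later. The first three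
    nonvanishing conditions make the orbit well defined, the last two are the nondegeneracy of the
    fibre at its starting point. The lower bounds on [r], [r + 1] and [r - 1] force all three
    coordinates to infinity. *)
Lemma escaping_ratios (R : realType) (b c : R[i]) :
  exists r t : nat -> R[i],
  [/\ forall n, r n.+1 = mean_ratio b c (r n) (t n) * (gap_ratio b c (r n) (t n))^-1,
      forall n, t n.+1 = t n * (gap_ratio b c (r n) (t n))^-1,
      forall n, [/\ t n != 0, 2 * (9 * r n ^+ 2 - 1) != 0, gap_ratio b c (r n) (t n) != 0,
        mean_ratio b c (r n) (t n) - r n != 0 &
        mean_ratio b c (r n) (t n) - 3 * r n * gap_ratio b c (r n) (t n) - 4 * r n != 0],
      exists2 k : R, 0 <= k < 1 & forall n, normc (t n) <= normc (t 0%N) * k ^+ n &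
      exists2 k : R, 0 < k & forall n,
        [/\ k <= normc (r n), k <= normc (r n + 1) & k <= normc (r n - 1)]].
Proof.
pose sq : R := Num.sqrt 7; pose q : R[i] := sq%:C.
have sq7 : sq ^+ 2 = 7 by rewrite sqr_sqrtr.
have sq0 : 0 <= sq by exact: sqrtr_ge0.
(* Exactly what makes the multiplier in [t], of norm [3 / (1 + sq)], smaller than 1. *)
have sq2 : 2 < sq by nra.
have natC (x : nat) : x%:R = (x%:R : R)%:C :> R[i] by rewrite rmorph_nat.
have hq : q ^+ 2 = 7 by rewrite /q -rmorphXn sq7 rmorph_nat.
pose r0 : R[i] := sqrtc ((11 - 4 * q) / 3).
have hr : r0 ^+ 2 = (11 - 4 * q) / 3 by rewrite /r0 sqr_sqrtc.
have r00 : r0 != 0.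
  have : r0 ^+ 2 != 0.
    by rewrite hr; apply: (@neq0_of_mulr_eq1 _ _ ((11 + 4 * q) / 3)); field: hq.
  by rewrite expf_eq0.
have : r0 ^+ 2 - 1 != 0.
  by rewrite hr; apply: (@neq0_of_mulr_eq1 _ _ (- (2 + q) / 4)); field: hq.
rewrite (_ : _ - 1 = (r0 - 1) * (r0 + 1)); last by ring.
rewrite mulf_eq0 negb_or => /andP[r0m r0p].
have q5 : 5 - q != 0.
  by apply: (@neq0_of_mulr_eq1 _ _ ((5 + q) / 18)); field: hq.
have q4 : 4 + q != 0.
  by apply: (@neq0_of_mulr_eq1 _ _ ((4 - q) / 9)); field: hq.
have n3 : normc (3 : R[i]) = 3 by rewrite natC normc_real ger0_norm.
have mean_sd := strict_diff_mean_ratio b c hq hr.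
have gap_sd := strict_diff_gap_ratio b c hq hr.
have gap0 := gap_ratio_neq0 hq.
have r_sd := strict_diff_fst r0 0.
(* Half the distance from [r0] to the nearest of 0, 1 and -1; points within [k] of [r0] keep
   distance [k] from these three. *)
pose k := Num.min (normc r0) (Num.min (normc (r0 + 1)) (normc (r0 - 1))) / 2.
have k0 : 0 < k by rewrite divr_gt0// !lt_min !normc_gt0 r00 r0m r0p.
have [|||||r [t [rS tS P tn0 tk]]] := @saddle_orbit R r0 _ _ _ _ _ _ _
  (strict_diff_quotient b c hq hr) (strict_diffV gap_sd gap0) _ _ _
  (near_pt_and (strict_diff_cont r_sd k0)
  (near_pt_and (strict_diff_neq (strict_diff_denV hq hr) (iden_neq0 hq hr))
  (near_pt_and (strict_diff_neq gap_sd gap0)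
  (near_pt_and (@strict_diff_neq _ _ _ _ _ _ _ 0 (strict_diffB mean_sd r_sd) _)
    (@strict_diff_neq _ _ _ _ _ _ _ 0 (strict_diffB (strict_diffB mean_sd
      (strict_diffM (strict_diffM (strict_diff_cst r0 0 3) r_sd) gap_sd))
      (strict_diffM (strict_diff_cst r0 0 4) r_sd)) _))))).
- rewrite normcN natC -raddfD normc_real ger0_norm; lra.
- by rewrite invr_neq0.
- rewrite normcV invf_lt1 ?normc_gt0// normcN normcM normcV n3.
  have -> : 1 + q = (1 + sq)%:C by rewrite rmorphD rmorph1.
  rewrite normc_real ger0_norm; lra.
- rewrite (_ : _ - _ = - (4 + q) / 3 * r0); last by field.
  by rewrite !mulf_neq0 ?oppr_eq0 ?invr_eq0.
- rewrite (_ : _ - _ = - (2 * (5 - q)) / 3 * r0); last by field.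
  by rewrite !mulf_neq0 ?oppr_eq0 ?invr_eq0 ?mulf_neq0.
exists r, t; split=> //.
  move=> n; have [_ [/invr_neq0]] := P n; rewrite invrK.
  by move=> d0 [g0 [m0 m1]]; split.
exists k => // n; have [rk _] := P n.
have kle : k * 2 <= normc r0 /\ k * 2 <= normc (r0 + 1) /\ k * 2 <= normc (r0 - 1).
  by rewrite /k divfK// !ge_min !lexx !orbT.
have := normc_ler_add r0 (r n) 0; rewrite !subr0.
have := normc_ler_add r0 (r n) 1; have := normc_ler_add r0 (r n) (- 1).
rewrite !opprK (normc_distC r0); split; lra.
Qed.

(** * Escaping orbits *)

Definition triple (F : fieldType) (x y z : F) : 'I_3 -> F :=
  fun k => nth 0 [:: x; y; z] k.

Lemma triple_eq (F : fieldType) (f : 'I_3 -> F) (x y z : F) :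
  f ord0 = x -> f (lift ord0 ord0) = y -> f ord_max = z -> f = triple x y z.
Proof.
move=> fx fy fz; apply/funext => -[[|[|[|]]] // hk]; rewrite /triple /=.
- by rewrite -fx; congr f; apply/val_inj.
- by rewrite -fy; congr f; apply/val_inj.
- by rewrite -fz; congr f; apply/val_inj.
Qed.

Lemma triple_inj (F : fieldType) (x y z : F) :
  x != y -> x != z -> y != z -> injective (triple x y z).
Proof.
move=> /eqP xy /eqP xz /eqP yz [[|[|[|]]] // h1] [[|[|[|]]] // h2]; rewrite /triple /= => e;
  first [exact/val_inj | by case: xy | by case: xz | by case: yz].
Qed.

Lemma weierstrass_triple (F : fieldType) (p : {poly F}) (x y z : F) :
  weierstrass p (triple x y z) = triple
    (x - p.[x] / lead_coef p / ((x - y) * (x - z)))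
    (y - p.[y] / lead_coef p / ((y - x) * (y - z)))
    (z - p.[z] / lead_coef p / ((z - x) * (z - y))).
Proof.
apply: triple_eq; rewrite /weierstrass big_mkcond !big_ord_recl big_ord0 /triple /=;
  by rewrite ?mul1r ?mulr1.
Qed.

(** Translation to the centroid [a] of the roots removes the quadratic term. *)
Lemma depressed_cubic (F : numFieldType) (p : {poly F}) : size p = 4%N ->
  exists a b c : F, forall x, p.[a + x] / lead_coef p = x ^+ 3 + b * x + c.
Proof.
move=> hp; set l := lead_coef p.
have l0 : l != 0 by rewrite lead_coef_eq0 -size_poly_eq0 hp.
have lE : p`_3 = l by rewrite /l lead_coefE hp.
pose A := p`_2 / l; pose a := - A / 3.
exists a, (3 * a ^+ 2 + 2 * A * a + p`_1 / l),
  (a ^+ 3 + A * a ^+ 2 + p`_1 / l * a + p`_0 / l) => x.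
rewrite horner_coef hp !big_ord_recl big_ord0 /= /bump /= !add1n lE /a /A.
by field.
Qed.

(** By interpolation at the [z_k], the image of [z] is [w] as soon as the monic cubic equals [(Z -
    z_1)(Z - z_2)(Z - z_3) + sum_k (z_k - w_k) prod_(j != k) (Z - z_j)]. The coefficients of [Z ^ 2]
    agree because [w] has centroid [a]. The second equation compares the coefficients of [Z]; the
    first combines it with the constant terms so that the quadratic terms in [S] and [D] cancel. *)
Lemma weierstrass_fibre (F : numFieldType) (p : {poly F}) (a b c n e S D t : F) :
  (forall x, p.[a + x] / lead_coef p = x ^+ 3 + b * x + c) ->
  D != 0 -> (S + D) / 2 - t != 0 -> (S - D) / 2 - t != 0 ->
  e * (t + 2 * n) * D = - (S * (2 * t + n) * (t + 2 * n)) +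
    2 * (t + n) * (2 * n * t - b) - c ->
  (S * S - D * D) / 4 + (t + n) * S + e * D - 2 * n * t + b = 0 ->
  weierstrass p (triple (a + (S + D) / 2) (a + (S - D) / 2) (a + t)) =
    triple (a + (n + e)) (a + (n - e)) (a - 2 * n).
Proof.
move=> pE D0 d1 d2 eq1 eq2; rewrite weierstrass_triple !pE.
have eq1' : e * (t + 2 * n) * D + S * (2 * t + n) * (t + 2 * n)
  - 2 * (t + n) * (2 * n * t - b) + c = 0 by rewrite eq1; ring.
(* [G1 * Z - G2] is the difference between p(Z) and the polynomial
   (Z - z_1)(Z - z_2)(Z - z_3) + sum_k (z_k - w_k) prod_(j != k) (Z - z_j). *)
pose G1 := (S * S - D * D) / 4 + (t + n) * S + e * D - 2 * n * t + b.
pose G2 := 2 * (t + n) * G1 - (e * (t + 2 * n) * D + S * (2 * t + n) * (t + 2 * n)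
  - 2 * (t + n) * (2 * n * t - b) + c).
have G10 : G1 = 0 by [].
have G20 : G2 = 0 by rewrite /G2 G10 eq1' mulr0 subr0.
have quo (x w u v : F) : u != 0 -> v != 0 ->
    x ^+ 3 + b * x + c = (x - w) * (u * v) + G1 * x - G2 ->
    a + x - (x ^+ 3 + b * x + c) / (u * v) = a + w.
  by move=> u0 v0 ->; rewrite G10 G20; field; rewrite u0 v0.
have -> : a + (S + D) / 2 - (a + (S - D) / 2) = D by field.
have -> : a + (S + D) / 2 - (a + t) = (S + D) / 2 - t by ring.
have -> : a + (S - D) / 2 - (a + (S + D) / 2) = - D by field.
have -> : a + (S - D) / 2 - (a + t) = (S - D) / 2 - t by ring.
have -> : a + t - (a + (S + D) / 2) = - ((S + D) / 2 - t) by ring.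
have -> : a + t - (a + (S - D) / 2) = - ((S - D) / 2 - t) by ring.
by congr triple; apply: quo; rewrite ?oppr_eq0 // /G2 /G1; field.
Qed.

(** The sign [s] records the order of the first two coordinates. In terms of the new [r] and [t] the
    image has the same shape with [- s] in place of [s]. *)
Lemma weierstrass_step (F : numFieldType) (p : {poly F}) (a b c r t s : F) :
  (forall x, p.[a + x] / lead_coef p = x ^+ 3 + b * x + c) ->
  t != 0 -> 2 * (9 * r ^+ 2 - 1) != 0 -> s = 1 \/ s = - 1 ->
  weierstrass p (triple (a + (r + s) / t) (a + (r - s) / t) (a - 2 * r / t)) =
    triple (a + (mean_ratio b c r t - s * gap_ratio b c r t) / t)
      (a + (mean_ratio b c r t + s * gap_ratio b c r t) / t)
      (a - 2 * mean_ratio b c r t / t).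
Proof.
move=> pE t0 den s1; rewrite weierstrass_triple.
have [] : 3 * r + 1 != 0 /\ 3 * r - 1 != 0.
  apply/andP; rewrite -negb_or -mulf_eq0; apply: contraNneq den => h.
  by rewrite (_ : _ - 1 = 0) ?mulr0// -h; ring.
move=> rp rm; have [rsp rsm] : 3 * r + s != 0 /\ 3 * r - s != 0.
  by case: s1 => ->; rewrite ?opprK.
have s0 : s != 0 by case: s1 => ->; rewrite ?oppr_eq0 oner_eq0.
rewrite !pE.
have -> : a + (r + s) / t - (a + (r - s) / t) = 2 * s / t by field.
have -> : a + (r + s) / t - (a - 2 * r / t) = (3 * r + s) / t by field.
have -> : a + (r - s) / t - (a + (r + s) / t) = - (2 * s / t) by field.
have -> : a + (r - s) / t - (a - 2 * r / t) = (3 * r - s) / t by field.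
have -> : a - 2 * r / t - (a + (r + s) / t) = - ((3 * r + s) / t) by field.
have -> : a - 2 * r / t - (a + (r - s) / t) = - ((3 * r - s) / t) by field.
have r9 : 9 * r ^+ 2 - 1 != 0 by apply: contraNneq den => ->; rewrite mulr0.
rewrite /mean_ratio /gap_ratio.
by case: s1 => se; subst s; congr triple; field; rewrite ?t0 ?rp ?rm ?r9.
Qed.

Lemma escaping_weierstrass (R : realType) d (p : {poly R[i]}) (z : 'I_d -> R[i]) :
  escaping p z -> escaping p (weierstrass p z).
Proof.
move=> [od esc]; split=> [n|k M]; first by rewrite -iterSr; apply: od.
have [N _ H] := esc k M; exists N => // n /= Nn; rewrite -iterSr.
by apply: H; apply: leqW.
Qed.

(** Lets escape be pulled back along a fibre at points off the diagonal. *)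
Lemma escaping_of_weierstrass (R : realType) d (p : {poly R[i]}) (z : 'I_d -> R[i]) :
  injective z -> escaping p (weierstrass p z) -> escaping p z.
Proof.
move=> zi [od esc]; split=> [[|n]|k M]; [exact: zi|by rewrite iterSr; apply: od|].
have [N _ H] := esc k M; exists N.+1 => // -[|n] //= Nn.
by rewrite -iterS iterSr; apply: H.
Qed.

Lemma escaping_of_ratios (R : realType) (p : {poly R[i]}) (a b c : R[i])
    (r t : nat -> R[i]) (k k' : R) :
  (forall x, p.[a + x] / lead_coef p = x ^+ 3 + b * x + c) ->
  (forall n, r n.+1 = mean_ratio b c (r n) (t n) * (gap_ratio b c (r n) (t n))^-1) ->
  (forall n, t n.+1 = t n * (gap_ratio b c (r n) (t n))^-1) ->
  (forall n, [/\ t n != 0, 2 * (9 * r n ^+ 2 - 1) != 0 & gap_ratio b c (r n) (t n) != 0]) ->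
  0 <= k < 1 -> (forall n, normc (t n) <= normc (t 0%N) * k ^+ n) ->
  0 < k' -> (forall n, [/\ k' <= normc (r n), k' <= normc (r n + 1) & k' <= normc (r n - 1)]) ->
  escaping p (triple (a + (r 0%N + 1) / t 0%N) (a + (r 0%N - 1) / t 0%N)
    (a - 2 * r 0%N / t 0%N)).
Proof.
move=> pE rS tS nz /andP[k0 k1] tk k'0 rk.
(* The alternating sign undoes the exchange of the first two coordinates built into [gap_ratio]. *)
pose s n : R[i] := (-1) ^+ n.
have s1 n : s n = 1 \/ s n = -1.
  by rewrite /s -signr_odd; case: (odd n); [right|left].
have orbit n : iter n (weierstrass p) (triple (a + (r 0%N + 1) / t 0%N)
    (a + (r 0%N - 1) / t 0%N) (a - 2 * r 0%N / t 0%N)) =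
  triple (a + (r n + s n) / t n) (a + (r n - s n) / t n) (a - 2 * r n / t n).
  elim: n => [|n IH]; first by rewrite /s expr0.
  have [t0 d0 g0] := nz n.
  rewrite iterS IH (weierstrass_step pE)// rS tS.
  rewrite /s exprS -/(s n) /s.
  by congr triple; field; rewrite t0 g0.
split=> [n|j M].
  rewrite orbit; have [t0 d0 _] := nz n.
  have [] : 3 * r n + 1 != 0 /\ 3 * r n - 1 != 0.
    apply/andP; rewrite -negb_or -mulf_eq0; apply: contraNneq d0 => h.
    by rewrite (_ : _ - 1 = 0) ?mulr0// -h; ring.
  move=> rp rm; have [rsp rsm] : 3 * r n + s n != 0 /\ 3 * r n - s n != 0.
    by case: (s1 n) => ->; rewrite ?opprK.
  have s0 : s n != 0 by case: (s1 n) => ->; rewrite ?oppr_eq0 oner_eq0.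
  apply: triple_inj; rewrite -subr_eq0.
  - rewrite (_ : _ - _ = 2 * s n / t n); last by field.
    by rewrite !mulf_neq0 ?invr_eq0.
  - rewrite (_ : _ - _ = (3 * r n + s n) / t n); last by field.
    by rewrite !mulf_neq0 ?invr_eq0.
  - rewrite (_ : _ - _ = (3 * r n - s n) / t n); last by field.
    by rewrite !mulf_neq0 ?invr_eq0.
(* Each coordinate is [a + u / t n] with [normc u] at least [k']; once [normc (t n) < k' / M'], the
   quotient exceeds [M'], which leaves room for subtracting [a]. *)
pose M' := `|M| + normc a + 1.
have M'0 : 0 < M' by rewrite /M'; have := normc_ge0 a; have := normr_ge0 M; lra.
have e0 : 0 < k' / M' by rewrite divr_gt0.
have : (fun n => normc (t 0%N) * k ^+ n) @ \oo --> (0 : R).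
  by rewrite -[0](mulr0 (normc (t 0%N))); apply: cvgMr; apply: cvg_expr; rewrite ger0_norm.
move=> /cvgrPdist_lt/(_ _ e0); apply: filterS => n.
rewrite sub0r normrN ger0_norm ?mulr_ge0 ?normc_ge0 ?exprn_ge0// => tn.
have {tn} tn := le_lt_trans (tk n) tn.
have [t0 _ _] := nz n.
have tp : 0 < normc (t n) by rewrite normc_gt0.
have key (u : R[i]) : k' <= normc u -> M%:C < `|a + u / t n|.
  move=> ku; rewrite normr_normc ltcR.
  have h : M' < normc (u / t n).
    rewrite normcM normcV ltr_pdivlMr//; apply: lt_le_trans ku.
    by rewrite -ltr_pdivlMl// mulrC.
  have := ler_normcD (a + u / t n) (- a); rewrite normcN addrC addKr.
  by have := ler_norm M; rewrite /M' in h; lra.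
have [kr kp km] := rk n.
rewrite orbit /triple; case: j => -[|[|[|]]] //= _.
- by apply: key; case: (s1 n) => ->.
- by apply: key; case: (s1 n) => ->; rewrite ?opprK.
- rewrite -mulNr; apply: key; rewrite -mulNr normcM normcN.
  have -> : normc (2 : R[i]) = 2.
    by rewrite (_ : 2 = (2 : R)%:C) ?normc_real ?ger0_norm// rmorph_nat.
  lra.
Qed.

(** * Holomorphic branches of a fibre *)

Definition holo (R : realType) (f : R[i] -> R[i]) (t : R[i]) : Prop :=
  @derivable R[i] (R[i])^o (R[i])^o (f : (R[i])^o -> (R[i])^o) t 1.

Section Holo.
Variable R : realType.
Implicit Types (f g : R[i] -> R[i]) (t : R[i]).

Lemma holo_cst (x : R[i]) t : holo (fun _ => x) t.
Proof. exact: (@derivable_cst _ (R[i])^o (R[i])^o). Qed.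

Lemma holo_id t : holo (fun x => x) t.
Proof. exact: (@derivable_id _ (R[i])^o). Qed.

Lemma holoD f g t : holo f t -> holo g t -> holo (fun x => f x + g x) t.
Proof. exact: (@derivableD _ (R[i])^o (R[i])^o). Qed.

Lemma holoN f t : holo f t -> holo (fun x => - f x) t.
Proof. exact: (@derivableN _ (R[i])^o (R[i])^o). Qed.

Lemma holoM f g t : holo f t -> holo g t -> holo (fun x => f x * g x) t.
Proof. exact: (@derivableM _ (R[i])^o). Qed.

Lemma holoV f t : f t != 0 -> holo f t -> holo (fun x => (f x)^-1) t.
Proof. exact: (@derivableV _ (R[i])^o). Qed.

Lemma holo_cont f t : holo f t -> forall e, 0 < e ->
  exists2 d : R, 0 < d & forall x, normc (x - t) < d -> normc (f x - f t) < e.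
Proof.
move=> /derivable1_diffP/differentiable_continuous /cvgrPdist_lt H e e0.
have e0' : 0 < e%:C by rewrite ltcR.
have /nbhs_ballP[d /= d0 Hd] := H _ e0'.
(* A positive element of [R[i]] is real, so the radius can be taken in [R]. *)
have dR : d = (complex.Re d)%:C by rewrite RRe_real// gtr0_real.
exists (complex.Re d); first by rewrite -ltcR -dR.
move=> x xt; have /= := Hd x; rewrite -ball_normE /= distrC normr_normc dR ltcR => /(_ xt).
by rewrite distrC normr_normc ltcR.
Qed.
End Holo.

Lemma Re_sqrtc_gt0 (R : rcfType) (x : R[i]) : 0 < complex.Re x -> 0 < complex.Re (sqrtc x).
Proof.
case: x => a b /= a0; rewrite sqrtr_gt0 divr_gt0// ltr_wpDl// sqrtr_ge0.
Qed.

(** With [s] and [u] the roots of [t] and [h + t], [h = (u - s) * (u + s)]. The difference quotient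
    is therefore [(u + s)^-1], and it differs from [(2 * s)^-1] by [h / (2 * s * (u + s) ^+ 2)]. *)
Lemma holo_sqrtc (R : realType) (t : R[i]) : 0 < complex.Re t -> holo (@sqrtc R) t.
Proof.
move=> t0; set s := sqrtc t.
have s0 : 0 < complex.Re s by exact: Re_sqrtc_gt0.
have sn0 : s != 0 by apply: contraTneq s0 => ->; rewrite ltxx.
apply/cvg_ex; exists ((2 * s)^-1).
apply/cvgrPdist_lt => e e0.
have eR : e = (complex.Re e)%:C by rewrite RRe_real// gtr0_real.
have e0' : 0 < complex.Re e by rewrite -ltcR -eR.
(* The first bound keeps [h + t] in the right half-plane, so that [s] and [u + s] have norm at least
   [complex.Re s]; the second then yields the error [e]. *)
pose d := Num.min (complex.Re t) (complex.Re e * complex.Re s ^+ 3).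
have d0 : 0 < d by rewrite lt_min t0 mulr_gt0 ?exprn_gt0.
apply/nbhs_ballP; exists d%:C => /=; first by rewrite ltcR.
move=> h; rewrite -ball_normE /= sub0r normrN normr_normc ltcR => hd hn0.
rewrite normr_normc eR ltcR.
have -> : h%:A + t = h + t by congr (_ + _); exact: mulr1.
have -> : h^-1 *: (sqrtc (h + t) - s : (R[i])^o) = h^-1 * (sqrtc (h + t) - s) by [].
set u := sqrtc (h + t).
have [hd1 hd2] : normc h < complex.Re t /\ normc h < complex.Re e * complex.Re s ^+ 3.
  by apply/andP; rewrite -lt_min.
have u0 : 0 < complex.Re u.
  apply: Re_sqrtc_gt0; rewrite raddfD /=.
  by have := ler_Re_normc h; rewrite ler_norml => /andP[]; lra.
have su : complex.Re s <= normc (u + s).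
  by have := ler_Re_normc (u + s); rewrite raddfD /= ler_norml => /andP[]; lra.
have ss : complex.Re s <= normc s.
  by have := ler_Re_normc s; rewrite ler_norml => /andP[]; lra.
have usn0 : u + s != 0 by rewrite -normc_gt0; lra.
have hE : h = (u - s) * (u + s).
  by rewrite -subr_sqr !sqr_sqrtc addrK.
have un : u - s != 0 by apply: contraNneq hn0 => e1; rewrite hE e1 mul0r.
have -> : (2 * s)^-1 - h^-1 * (u - s) = h * (2 * s * (u + s) ^+ 2)^-1.
  by rewrite hE; field; rewrite sn0 usn0 un.
have n2 : normc (2 : R[i]) = 2.
  by rewrite (_ : 2 = (2 : R)%:C) ?normc_real ?ger0_norm// rmorph_nat.
rewrite normcM normcV !normcM n2 ltr_pdivrMr; last first.
  by rewrite !mulr_gt0 // normc_gt0.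
have s2 : complex.Re s * complex.Re s <= normc (u + s) * normc (u + s).
  by rewrite ler_pM// ltW.
have s3 : complex.Re s * (complex.Re s * complex.Re s) <= normc s * (normc (u + s) * normc (u + s)).
  by rewrite ler_pM ?mulr_ge0 // ltW.
have s4 := ler_wpM2l (ltW e0') s3.
apply: lt_le_trans hd2 _; rewrite !exprS expr0.
have : 0 < complex.Re e * (normc s * (normc (u + s) * normc (u + s))).
  by rewrite !mulr_gt0 // normc_gt0.
lra.
Qed.

Lemma holo_comp (R : realType) (f g : R[i] -> R[i]) (t : R[i]) :
  holo f t -> holo g (f t) -> holo (fun x => g (f x)) t.
Proof.
move=> /derivable1_diffP hf /derivable1_diffP hg.
apply/derivable1_diffP.
exact: (@differentiable_comp _ (R[i])^o (R[i])^o (R[i])^o f g t hf hg).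
Qed.

Lemma holo_neq0 (R : realType) (f : R[i] -> R[i]) (t : R[i]) :
  holo f t -> f t != 0 ->
  exists2 d : R, 0 < d & forall x, normc (x - t) < d -> f x != 0.
Proof.
move=> hf ft; have [|d d0 H] := holo_cont hf (_ : 0 < normc (f t)).
  by rewrite normc_gt0.
exists d => // x /H; rewrite normc_distC; apply: contraTneq => ->.
by rewrite subr0 ltxx.
Qed.

#[local] Opaque holo.

Ltac holo_tac := cbv beta;
  match goal with
  | |- holo (fun x => x) _ => exact (@holo_id _ _)
  | |- holo (fun x => ?c) _ => exact (@holo_cst _ c _)
  | |- holo (fun x => (@?f x + @?g x)%R) _ => apply (@holoD _ f g); holo_tac
  | |- holo (fun x => (- @?f x)%R) _ => apply (@holoN _ f); holo_tac
  | |- holo (fun x => (@?f x * @?g x)%R) _ => apply (@holoM _ f g); holo_tac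
  | |- holo (fun x => (@?f x)^-1%R) _ => apply (@holoV _ f); [cbv beta|holo_tac]
  | H : holo ?f ?t |- holo (fun x => ?f x) ?t => exact H
  | H : ?P |- ?P => exact H
  | _ => idtac
  end.

(** Here [(m, d)] describes the base point and [(n, e)] its image; the last two hypotheses are the
    fibre equations at [t = - (2 * m)], [S = 2 * m], [D = 2 * d]. The conditions on [e] and [n - m]
    allow the linear equation to be solved for [D]. The third nonvanishing condition says that the
    remaining quadratic equation has a simple root in [S] at the base point. *)
Lemma fibre_branch (R : realType) (b c m d n e : R[i]) :
  e != 0 -> n - m != 0 -> 3 * m * e + d * n - 4 * m * d != 0 ->
  e * (2 * n - 2 * m) * (2 * d) =
    - (2 * m * (n - 4 * m) * (2 * n - 2 * m)) +
    2 * (n - 2 * m) * (- (4 * m * n) - b) - c ->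
  m ^+ 2 - d ^+ 2 + 2 * m * (n - 2 * m) + 2 * e * d + 4 * m * n + b = 0 ->
  exists r : R, exists S D : R[i] -> R[i],
  [/\ 0 < r, S (- (2 * m)) = 2 * m, D (- (2 * m)) = 2 * d &
    forall t, normc (t - - (2 * m)) < r -> [/\ holo S t, holo D t,
      e * (t + 2 * n) * D t = - (S t * (2 * t + n) * (t + 2 * n)) +
        2 * (t + n) * (2 * n * t - b) - c &
      (S t * S t - D t * D t) / 4 + (t + n) * S t + e * D t - 2 * n * t + b = 0 ]].
Proof.
move=> e0 nm0 nd hi hii.
(* The linear equation reads [D = L * S + N]. Substituting it and [S = 2 * m + h] turns the
   quadratic one into [A * h ^+ 2 + B * h + Q = 0], simplified by [e * L = - (2 * t + n)]; its
   discriminant is [B ^+ 2 * X]. *)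
pose L t := - ((2 * t + n) * e^-1).
pose N t := (2 * (t + n) * (2 * n * t - b) - c) * (e * (t + 2 * n))^-1.
pose A t := (1 - L t * L t) * 4^-1.
pose B t := 4 * m * A t - L t * N t * 2^-1 - t.
pose Q t := 4 * m * m * A t + 2 * m * (- (L t * N t * 2^-1) - t)
  + (- (N t * N t * 4^-1) + e * N t - 2 * n * t + b).
pose X t := 1 - 4 * A t * Q t * (B t * B t)^-1.
(* The root of [A h^2 + B h + Q] that vanishes with [Q], in a form that is valid
   also where [A] vanishes. *)
pose h t := - (2 * Q t) * (B t * (1 + sqrtc (X t)))^-1.
pose S t := 2 * m + h t.
pose D t := L t * S t + N t.
pose t0 := - (2 * m).
have tn0 : t0 + 2 * n != 0.
  by rewrite (_ : _ + _ = 2 * (n - m)) ?mulf_neq0// /t0; ring.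
have N0 : 2 * d = L t0 * (2 * m) + N t0.
  apply: (mulfI (_ : e * (t0 + 2 * n) != 0)); first by rewrite mulf_neq0.
  have -> : e * (t0 + 2 * n) * (2 * d) = e * (2 * n - 2 * m) * (2 * d) by rewrite /t0; ring.
  by rewrite hi /L /N /t0; field; rewrite e0 andbT.
have N0' : N t0 = 2 * d - L t0 * (2 * m) by rewrite N0; ring.
have B0 : B t0 != 0.
  have -> : B t0 = (3 * m * e + d * n - 4 * m * d) / e.
    by rewrite /B /A N0' /L /t0; field.
  by rewrite mulf_neq0 ?invr_eq0.
have Q0 : Q t0 = 0.
  by rewrite -hii /Q /A N0' /L /t0; field.
have X0 : X t0 = 1 by rewrite /X Q0 mulr0 mul0r subr0.
have hL t : holo L t by rewrite /L; holo_tac.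
have hN t : t + 2 * n != 0 -> holo N t.
  by move=> tn; rewrite /N; holo_tac; rewrite mulf_neq0.
have hA t : holo A t by have ? := hL t; rewrite /A; holo_tac.
have hB t : t + 2 * n != 0 -> holo B t.
  by move=> /hN ?; have := hL t; have := hA t; rewrite /B => *; holo_tac.
have hQ t : t + 2 * n != 0 -> holo Q t.
  by move=> /hN ?; have := hL t; have := hA t; rewrite /Q => *; holo_tac.
have hX t : t + 2 * n != 0 -> B t != 0 -> holo X t.
  move=> tn Bn; have := hA t; have := hB t tn; have := hQ t tn.
  by rewrite /X => *; holo_tac; rewrite mulf_neq0.
have s1 t : 0 < complex.Re (X t) -> 1 + sqrtc (X t) != 0.
  move=> /Re_sqrtc_gt0; apply: contraTneq => /(congr1 (@complex.Re R)).
  by rewrite raddfD /= => ?; rewrite -leNgt; lra.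
have hS t : t + 2 * n != 0 -> B t != 0 -> 0 < complex.Re (X t) -> holo S t.
  move=> tn Bn Xn; have h1 := holoD (@holo_cst _ 1 t) (holo_comp (hX t tn Bn) (holo_sqrtc Xn)).
  apply (@holoD _ (fun=> 2 * m) h); first exact: holo_cst.
  apply (@holoM _ (fun x => - (2 * Q x)) (fun x => (B x * (1 + sqrtc (X x)))^-1)).
    exact: holoN (holoM (@holo_cst _ 2 t) (hQ t tn)).
  apply: holoV; last exact: holoM (hB t tn) h1.
  by rewrite mulf_neq0 ?s1.
have [r1 r10 H1] := holo_neq0 (holoD (@holo_id _ t0) (@holo_cst _ (2 * n) t0)) tn0.
have [r2 r20 H2] := holo_neq0 (hB t0 tn0) B0.
(* Since [X t0 = 1], staying within distance 1 keeps [X] in the right half-plane, where [sqrtc] is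
   holomorphic. *)
have [r3 r30 H3] := holo_cont (hX t0 tn0 B0) ltr01.
exists (Num.min r1 (Num.min r2 r3)), S, D.
have S0 : S t0 = 2 * m by rewrite /S /h Q0 mulr0 oppr0 mul0r addr0.
split.
- by rewrite !lt_min r10 r20.
- exact: S0.
- by rewrite -/t0 /D S0 -N0.
move=> t; rewrite !lt_min => /and3P[/H1 tn /H2 Bn /H3].
rewrite X0 => Xn.
have {}Xn : 0 < complex.Re (X t).
  have := ler_Re_normc (X t - 1); rewrite raddfB /= ler_norml => /andP[+ _]; lra.
split.
- exact: hS.
- by have := hS t tn Bn Xn; have := hN t tn; have := hL t; rewrite /D => *; holo_tac.
- by rewrite /D /L /N; field; rewrite e0 tn.
- have {}s1 := s1 t Xn.
  have quad : A t * h t ^+ 2 + B t * h t + Q t = 0.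
    have hh : h t * (B t * (1 + sqrtc (X t))) = - (2 * Q t).
      by rewrite /h mulfVK// mulf_neq0.
    have sx : sqrtc (X t) * sqrtc (X t) = X t by rewrite -expr2 sqr_sqrtc.
    have Xe : X t * (B t * B t) = B t * B t - 4 * A t * Q t.
      by rewrite /X; field.
    set s := sqrtc _ in s1 hh sx.
    have : (A t * h t ^+ 2 + B t * h t + Q t) * ((B t * (1 + s)) ^+ 2) = 0.
      have -> : (A t * h t ^+ 2 + B t * h t + Q t) * ((B t * (1 + s)) ^+ 2) =
        A t * (h t * (B t * (1 + s))) ^+ 2 + B t * (h t * (B t * (1 + s))) * (B t * (1 + s))
        + Q t * ((B t * B t) * (1 + 2 * s + s * s)) by ring.
      rewrite hh sx.
      have -> : A t * (- (2 * Q t)) ^+ 2 + B t * - (2 * Q t) * (B t * (1 + s)) +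
         Q t * (B t * B t * (1 + 2 * s + X t)) =
         Q t * (4 * A t * Q t - B t * B t + X t * (B t * B t)) by ring.
      by rewrite Xe; ring.
    by move=> /eqP; rewrite mulf_eq0 expf_eq0 /= mulf_eq0 (negbTE Bn) (negbTE s1) !orbF => /eqP.
  by rewrite -quad /D /S /B /Q /A /L; field.
Qed.

(** * Escaping points and a holomorphic curve in a fibre through one of them *)

Theorem theorem3p9 (R : realType) (p : {poly R[i]}) (hp : size p = 4%N) :
  (exists z : 'I_3 -> R[i], escaping p z) /\
  (exists (c : R[i]) (r : R) (gamma : 'I_3 -> R[i] -> R[i]),
      0 < r /\
      (forall k : 'I_3, holomorphic_on_disk c r (gamma k)) /\
      (exists t1 t2 : R[i], `| t1 - c | < r%:C /\ `| t2 - c | < r%:C /\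
          exists k : 'I_3, gamma k t1 <> gamma k t2) /\
      (forall t : R[i], `| t - c | < r%:C -> escaping p (fun k => gamma k t))).
Proof.
have [a [b [c pE]]] := depressed_cubic hp.
have [r [t [rS tS nz [k k01 tk] [k' k'0 rk]]]] := escaping_ratios b c.
have esc : escaping p (triple (a + (r 0%N + 1) / t 0%N) (a + (r 0%N - 1) / t 0%N)
    (a - 2 * r 0%N / t 0%N)).
  by apply: escaping_of_ratios rS tS _ k01 tk k'0 rk => // n; have [] := nz n.
split; first by eexists; exact: esc.
have [t0 den0 gap0 mr0 nd0] := nz 0%N.
have escW := escaping_weierstrass esc.
rewrite (weierstrass_step pE t0 den0 (or_introl erefl)) in escW.
set x := r 0%N in den0 gap0 mr0 nd0 escW; set y := t 0%N in t0 gap0 mr0 nd0 escW.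
set mr := mean_ratio b c x y in mr0 nd0 escW.
set gr := gap_ratio b c x y in gap0 nd0 escW.
have [x1 x2] : 3 * x + 1 != 0 /\ 3 * x - 1 != 0.
  apply/andP; rewrite -negb_or -mulf_eq0; apply: contraNneq den0 => h.
  by rewrite (_ : _ - 1 = 0) ?mulr0// -h; ring.
have r9 : 9 * x ^+ 2 - 1 != 0 by apply: contraNneq den0 => ->; rewrite mulr0.
(* The minus sign in [- gr / y] reflects the exchange: the first coordinate of the image is
   [a + (mr - gr) / y]. *)
have [|||||rad [S [D [rad0 S0 D0 HSD]]]] :=
    @fibre_branch R b c (x / y) y^-1 (mr / y) (- gr / y).
- by rewrite mulf_neq0 ?invr_eq0 ?oppr_eq0.
- by rewrite -mulrBl mulf_neq0 ?invr_eq0.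
- rewrite (_ : _ - _ = (mr - 3 * x * gr - 4 * x) / y ^+ 2); last by field.
  by rewrite mulf_neq0 ?invr_eq0 ?expf_eq0.
- by rewrite /mr /gr /mean_ratio /gap_ratio; field; rewrite t0 r9.
- by rewrite /mr /gr /mean_ratio /gap_ratio; field; rewrite t0 r9.
set t1 := - (2 * (x / y)) in S0 D0 HSD.
have [|hS hD _ _] := HSD t1; first by rewrite subrr normc0.
have hid (s : R[i]) := holoN (@holo_id _ s).
have half (f : R[i] -> R[i]) s : holo f s -> holo (fun s => f s / 2) s.
  by move=> hf; exact: (holoM hf (@holo_cst _ 2^-1 s)).
(* [D] and the two expressions [(S + D) / 2 - t], [(S - D) / 2 - t] are the differences of the
   coordinates. At the base point they equal [2 / y], [(3 * x + 1) / y] and [(3 * x - 1) / y], so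
   the curve stays off the diagonal nearby. *)
have [|r1 r10 H1] := holo_neq0 hD.
  by rewrite D0 mulf_neq0 ?invr_eq0 ?pnatr_eq0.
have [|r2 r20 H2] := holo_neq0 (holoD (half _ _ (holoD hS hD)) (hid t1)).
  rewrite S0 D0 (_ : _ - _ = (3 * x + 1) / y) ?mulf_neq0 ?invr_eq0//.
  by rewrite /t1; field.
have [|r3 r30 H3] := holo_neq0 (holoD (half _ _ (holoD hS (holoN hD))) (hid t1)).
  rewrite S0 D0 (_ : _ - _ = (3 * x - 1) / y) ?mulf_neq0 ?invr_eq0//.
  by rewrite /t1; field.
pose rho := Num.min rad (Num.min r1 (Num.min r2 r3)).
have rho0 : 0 < rho by rewrite !lt_min rad0 r10 r20.
have lt_rho s : `|s - t1| < rho%:C ->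
    [/\ normc (s - t1) < rad, D s != 0, (S s + D s) / 2 - s != 0 & (S s - D s) / 2 - s != 0].
  rewrite normr_normc ltcR !lt_min => /and4P[s0 s1 s2 s3].
  by split; [|exact: H1|exact: H2|exact: H3].
exists t1, rho,
  (fun k s => triple (a + (S s + D s) / 2) (a + (S s - D s) / 2) (a + s) k).
split=> //; split; [|split].
- move=> j s /lt_rho[/HSD[hSs hDs _ _] _ _ _].
  case: j => -[|[|[|j]]] hj; last by exfalso.
  + exact: (holoD (@holo_cst _ a s) (half _ _ (holoD hSs hDs))).
  + exact: (holoD (@holo_cst _ a s) (half _ _ (holoD hSs (holoN hDs)))).
  + exact: (holoD (@holo_cst _ a s) (@holo_id _ s)).
(* The third coordinate is [a + s], an injective function of the parameter, so any two distinct
   parameters show that the curve is not constant. *)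
- exists t1, (t1 + (rho / 2)%:C); split; first by rewrite subrr normr0 ltcR.
  split.
    rewrite addrC addKr normr_normc normc_real ltcR ger0_norm; lra.
  exists ord_max; rewrite /triple /= => /addrI /eqP.
  rewrite -subr_eq0 opprD addNKr oppr_eq0 -(rmorph0 (real_complex R)).
  by rewrite (inj_eq (@complexI R)) gt_eqF// divr_gt0.
- move=> s /lt_rho[/HSD[_ _ e1 e2] d0 d1 d2].
  apply: escaping_of_weierstrass.
    apply: triple_inj; rewrite -subr_eq0.
    + by rewrite (_ : _ - _ = D s) //; field.
    + by rewrite (_ : _ - _ = (S s + D s) / 2 - s) //; ring.
    + by rewrite (_ : _ - _ = (S s - D s) / 2 - s) //; ring.
  rewrite (weierstrass_fibre pE d0 d1 d2 e1 e2).
  rewrite !mul1r in escW.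
  have -> : a + (mr / y + - gr / y) = a + (mr - gr) / y by ring.
  have -> : a + (mr / y - - gr / y) = a + (mr + gr) / y by ring.
  by have -> : a - 2 * (mr / y) = a - 2 * mr / y by ring.
Qed.
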